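(* Let $G\subseteq \mathrm{Cl}_n$ be a set of Clifford unitaries and $p$ a probability distribution on $G$ such that the frame operator $S=\sum_{g\in G}p(g)\,\omega(g)^\dagger M\omega(g)$ is invertible. For every $g\in\mathrm{Cl}_n$ let $\Lambda(g)$ be a quantum channel (completely positive and trace preserving map) on $n$ qubits. Let $O$ be a Hermitian observable and $\rho$ an $n$-qubit quantum state, and let $\mathrm{bias}=\bigl|\mathrm{Tr}(O\rho)-(O|S^{-1}\tilde S|\rho)\bigr|$ with $\tilde S=\sum_{g\in G}p(g)\,\omega(g)^\dagger M\omega(g)\Lambda(g)$. Then $$\mathrm{bias}\le \lVert O\rVert_{\mathrm{st}}\max_{a\in\mathbb{F}_2^{2n}}\lVert \mathrm{id}-\bar\Lambda_a\rVert_\diamond\le \lVert O\rVert_{\mathrm{st}}\max_{g\in\mathrm{Cl}_n}\lVert \mathrm{id}-\Lambda(g)\rVert_\diamond .$$ If moreover every $\Lambda(g)$ is a Pauli channel, then $$\mathrm{bias}\le \min\{\lVert O\rVert_2,\lVert O\rVert_{\mathrm{st}}\}\max_{a\in\mathbb{F}_2^{2n}}|1-\bar\lambda_a| .$$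
   Context: Let $n\ge1$, $d=2^n$. For operators $A,B$ on $(\mathbb{C}^2)^{\otimes n}$, $(A|B)=\mathrm{Tr}(A^\dagger B)$, and $|A)(B|$ denotes the superoperator $C\mapsto (B|C)\,A$; $(A|\mathcal{X}|B)=\mathrm{Tr}(A^\dagger\mathcal{X}(B))$ for a superoperator $\mathcal X$. For a unitary $g$, $\omega(g)$ is the map $A\mapsto gAg^\dagger$ and $\omega(g)^\dagger$ its adjoint $A\mapsto g^\dagger A g$. $E_x=|x\rangle\langle x|$ for $x\in\mathbb{F}_2^n$ and $M=\sum_{x}|E_x)(E_x|$. Pauli operators: $\sigma_a=\sigma_{a_1}\otimes\cdots\otimes\sigma_{a_n}$ for $a=(a_1,\dots,a_n)\in(\mathbb{F}_2^2)^n\cong\mathbb{F}_2^{2n}$ with $\sigma_{00}=\mathbb 1,\sigma_{01}=X,\sigma_{11}=Y,\sigma_{10}=Z$. For $z\in\mathbb{F}_2^n$, $Z_z=\bigotimes_i Z^{z_i}$. $\mathrm{Cl}_n$ is the $n$-qubit Clifford group (generated by Hadamard, phase and CNOT gates). For $g\in\mathrm{Cl}_n$ and $z\in\mathbb{F}_2^n$, $\Xi_z(g)$ denotes the Pauli operator $\sigma_b$ such that $g^\dagger Z_z g=\pm\sigma_b$. Define $s_a=\sum_{z\in\mathbb{F}_2^n}\sum_{g\in G:\,\Xi_z(g)=\sigma_a}p(g)$ and the averaged channels $\bar\Lambda_a=s_a^{-1}\sum_{z\in\mathbb{F}_2^n}\sum_{g\in G:\,\Xi_z(g)=\sigma_a}p(g)\Lambda(g)$.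 A Pauli channel is a map $\Lambda(\rho)=\sum_b q_b\sigma_b\rho\sigma_b$ with $q$ a probability vector; it satisfies $\Lambda(\sigma_a)=\lambda_a\sigma_a$; if $\Lambda(g)$ has eigenvalues $\lambda_a(g)$, set $\bar\lambda_a=s_a^{-1}\sum_{z}\sum_{g\in G:\,\Xi_z(g)=\sigma_a}p(g)\lambda_a(g)$. Stabilizer norm: $\lVert O\rVert_{\mathrm{st}}=d^{-1}\sum_{a\in\mathbb{F}_2^{2n}}|(\sigma_a|O)|$. $\lVert O\rVert_2=\sqrt{(O|O)}$ is the Hilbert–Schmidt norm and $\lVert\cdot\rVert_\diamond$ the diamond norm. (The quantity $(O|S^{-1}\tilde S|\rho)$ is the expected value of the shadow estimator $\hat o(g,x)=(O|S^{-1}\omega(g)^\dagger|E_x)$ when $g\sim p$ is drawn, $\omega(g)\Lambda(g)$ is applied to $\rho$ and the computational basis is measured.) *)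

(* Defs.v *)
From HB Require Import structures.
From mathcomp Require Import all_boot all_order all_algebra.
From mathcomp Require Import spectral complex.
From mathcomp Require Import boolp classical_sets reals.

Set Implicit Arguments.
Unset Strict Implicit.
Unset Printing Implicit Defensive.

Import Order.TTheory GRing.Theory Num.Theory.
Local Open Scope ring_scope.
Local Open Scope classical_set_scope.

Definition fmx (R : realType) (I : finType) := 'M[R[i]]_#|I|.

Definition ent {R : realType} {I : finType} (A : fmx R I) (i j : I) : R[i] :=
  A (enum_rank i) (enum_rank j).

Definition mkfmx {R : realType} {I : finType} (f : I -> I -> R[i]) : fmx R I :=
  \matrix_(i, j) f (enum_val i) (enum_val j).

Definition toC {R : realType} (x : R) : R[i] := Complex x 0.

Definition cabs {R : realType} (z : R[i]) : R := complex.Re `|z|.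

Definition dag {R : realType} {m n : nat} (A : 'M[R[i]]_(m, n)) : 'M[R[i]]_(n, m) :=
  (map_mx Num.conj A)^T.

Definition hs {R : realType} {m : nat} (A B : 'M[R[i]]_m) : R[i] := \tr (dag A *m B).

Definition herm_op {R : realType} {m : nat} (A : 'M[R[i]]_m) : Prop := dag A = A.

Definition psd {R : realType} {m : nat} (A : 'M[R[i]]_m) : Prop :=
  herm_op A /\ forall v : 'rV[R[i]]_m, 0 <= (v *m A *m dag v) 0 0.

Definition qstate {R : realType} {m : nat} (rho : 'M[R[i]]_m) : Prop :=
  psd rho /\ \tr rho = 1.

(* trace norm ||X||_1 = Tr sqrt(X^dagger X) = sum of the square roots of the
   eigenvalues of the (normal) matrix X^dagger X *)
Definition trnorm {R : realType} {m : nat} (X : 'M[R[i]]_m) : R :=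
  complex.Re (\sum_i sqrtC (spectral_diag (dag X *m X) 0 i)).

Definition linear_so {R : realType} {I : finType} (Phi : fmx R I -> fmx R I) : Prop :=
  forall (a : R[i]) (X Y : fmx R I), Phi (a *: X + Y) = a *: Phi X + Phi Y.

(* Phi (x) id_J acting on operators on I x J: Phi is applied blockwise *)
Definition ext_so {R : realType} {I J : finType} (Phi : fmx R I -> fmx R I)
  (X : fmx R (I * J)%type) : fmx R (I * J)%type :=
  mkfmx (fun p q : (I * J)%type =>
    ent (Phi (mkfmx (fun i j : I => ent X (i, p.2) (j, q.2)))) p.1 q.1).

Definition completely_positive {R : realType} {I : finType}
  (Phi : fmx R I -> fmx R I) : Prop :=
  forall (k : nat) (X : fmx R (I * 'I_k)%type), psd X -> psd (ext_so Phi X).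

Definition trace_preserving {R : realType} {I : finType}
  (Phi : fmx R I -> fmx R I) : Prop :=
  forall X : fmx R I, \tr (Phi X) = \tr X.

Definition channel {R : realType} {I : finType} (Phi : fmx R I -> fmx R I) : Prop :=
  [/\ linear_so Phi, completely_positive Phi & trace_preserving Phi].

Definition dnorm {R : realType} {I : finType} (Phi : fmx R I -> fmx R I) : R :=
  sup [set r : R | exists X : fmx R (I * I)%type,
                     trnorm X <= 1 /\ r = trnorm (ext_so Phi X)].

Definition id_minus {R : realType} {I : finType} (Phi : fmx R I -> fmx R I) :
  fmx R I -> fmx R I := fun X => X - Phi X.

Definition qb (n : nat) := {ffun 'I_n -> bool}.
Definition plab (n : nat) := {ffun 'I_n -> bool * bool}.

Definition Op (R : realType) (n : nat) := fmx R (qb n).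

(* single-qubit Pauli entries; sigma_00 = 1, sigma_01 = X, sigma_11 = Y,
   sigma_10 = Z; basis |0> = false, |1> = true; (row, column) *)
Definition pauli1 {R : realType} (b : bool * bool) (x y : bool) : R[i] :=
  match b with
  | (false, false) => (x == y)%:R
  | (false, true) => (x != y)%:R
  | (true, true) => if x == y then 0 else if x then 'i else - 'i
  | (true, false) => if x == y then (if x then -1 else 1) else 0
  end.

Definition pauli {R : realType} {n : nat} (a : plab n) : Op R n :=
  mkfmx (fun x y : qb n => \prod_(i < n) pauli1 (a i) (x i) (y i)).

Definition Zop {R : realType} {n : nat} (z : qb n) : Op R n :=
  pauli [ffun i => (z i, false)].

Definition Eop {R : realType} {n : nat} (x : qb n) : Op R n :=
  mkfmx (fun y w : qb n => ((y == x) && (w == x))%:R).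

Definition Mso {R : realType} {n : nat} (X : Op R n) : Op R n :=
  \sum_(x : qb n) hs (Eop x) X *: Eop x.

Definition omega {R : realType} {n : nat} (g X : Op R n) : Op R n := g *m X *m dag g.
Definition omegaD {R : realType} {n : nat} (g X : Op R n) : Op R n := dag g *m X *m g.

Definition hadamard {R : realType} {n : nat} (i : 'I_n) : Op R n :=
  mkfmx (fun x y : qb n =>
    ([forall j, (j != i) ==> (x j == y j)])%:R *
    (if x i && y i then -1 else 1) / sqrtC 2%:R).

Definition phase {R : realType} {n : nat} (i : 'I_n) : Op R n :=
  mkfmx (fun x y : qb n => (x == y)%:R * (if x i then 'i else 1)).

Definition cnot {R : realType} {n : nat} (c t : 'I_n) : Op R n :=
  mkfmx (fun x y : qb n =>
    (x == [ffun j => if j == t then addb (y t) (y c) else y j])%:R).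

Inductive clifford {R : realType} {n : nat} : Op R n -> Prop :=
  | cl_one : clifford 1%:M
  | cl_H (i : 'I_n) g : clifford g -> clifford (hadamard i *m g)
  | cl_S (i : 'I_n) g : clifford g -> clifford (phase i *m g)
  | cl_CX (c t : 'I_n) g : c != t -> clifford g -> clifford (cnot c t *m g).

Definition Xi_is {R : realType} {n : nat} (g : Op R n) (z : qb n) (a : plab n) : bool :=
  (dag g *m Zop z *m g == pauli a) || (dag g *m Zop z *m g == - pauli a).

Definition frameS {R : realType} {n : nat} (G : seq (Op R n)) (p : Op R n -> R)
  (X : Op R n) : Op R n :=
  \sum_(g <- G) toC (p g) *: omegaD g (Mso (omega g X)).

Definition frameSt {R : realType} {n : nat} (G : seq (Op R n)) (p : Op R n -> R)
  (Lam : Op R n -> Op R n -> Op R n) (X : Op R n) : Op R n :=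
  \sum_(g <- G) toC (p g) *: omegaD g (Mso (omega g (Lam g X))).

Definition s_coef {R : realType} {n : nat} (G : seq (Op R n)) (p : Op R n -> R)
  (a : plab n) : R :=
  \sum_(z : qb n) \sum_(g <- G | Xi_is g z a) p g.

Definition Lambar {R : realType} {n : nat} (G : seq (Op R n)) (p : Op R n -> R)
  (Lam : Op R n -> Op R n -> Op R n) (a : plab n) (X : Op R n) : Op R n :=
  toC (s_coef G p a)^-1 *:
    \sum_(z : qb n) \sum_(g <- G | Xi_is g z a) toC (p g) *: Lam g X.

Definition lambar {R : realType} {n : nat} (G : seq (Op R n)) (p : Op R n -> R)
  (lam : Op R n -> plab n -> R[i]) (a : plab n) : R[i] :=
  toC (s_coef G p a)^-1 *
    \sum_(z : qb n) \sum_(g <- G | Xi_is g z a) toC (p g) * lam g a.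

Definition pauli_channel {R : realType} {n : nat} (Phi : Op R n -> Op R n) : Prop :=
  exists q : plab n -> R,
    [/\ forall b, 0 <= q b, \sum_b q b = 1 &
        forall X, Phi X = \sum_b toC (q b) *: (pauli b *m X *m pauli b)].

Definition stnorm {R : realType} {n : nat} (O : Op R n) : R :=
  ((2 ^ n)%:R)^-1 * \sum_(a : plab n) cabs (hs (pauli a) O).

Definition hsnorm {R : realType} {n : nat} (O : Op R n) : R := Num.sqrt (complex.Re (hs O O)).

Definition bias {R : realType} {n : nat} (G : seq (Op R n)) (p : Op R n -> R)
  (Lam : Op R n -> Op R n -> Op R n) (Sinv : Op R n -> Op R n) (O rho : Op R n) : R :=
  cabs (\tr (O *m rho) - hs O (Sinv (frameSt G p Lam rho))).

(* Main.v *)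
(** Write M in the basis of the operators Z_z. As Cliffords map Pauli operators to
    signed Pauli operators and the signs cancel, both frame operators become
    combinations of the projectors |sigma_a)(sigma_a|:
    S = d^-1 sum_a s_a |sigma_a)(sigma_a| and
    S~ = d^-1 sum_a s_a |sigma_a)(sigma_a| Lambar_a.
    Invertibility of S forces s_a <> 0, so
    bias = | d^-1 sum_a (O|sigma_a) (sigma_a|(id - Lambar_a)|rho) |.
    Each factor (sigma_a|(id - Lambar_a)|rho) is at most the diamond norm of
    id - Lambar_a since sigma_a is unitary, and Lambar_a is a convex combination of
    the channels Lambda(g). For Pauli noise it equals (1 - lambar_a) (sigma_a|rho), and
    Cauchy-Schwarz with Parseval's identity gives the bound by the 2-norm. The
    trace norm is handled by duality with contractions. *)

Require Import Defs.
From HB Require Import structures.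
From mathcomp Require Import all_boot all_order all_algebra.
From mathcomp Require Import spectral complex.
From mathcomp Require Import boolp classical_sets reals.
From mathcomp Require Import ring.
Import Order.TTheory GRing.Theory Num.Theory.
Local Open Scope ring_scope.
Local Open Scope classical_set_scope.

Set Implicit Arguments.
Unset Strict Implicit.
Unset Printing Implicit Defensive.

(** * Real scalars inside the complex numbers *)

Section ComplexScalars.
Variable R : realType.
Local Notation C := R[i].

Lemma toCD (x y : R) : toC (x + y) = toC x + toC y.
Proof. exact: (rmorphD (real_complex R)). Qed.

Lemma toCM (x y : R) : toC (x * y) = toC x * toC y.
Proof. exact: (rmorphM (real_complex R)). Qed.

Lemma toCV (x : R) : toC x^-1 = (toC x)^-1.
Proof. exact: (fmorphV (real_complex R)). Qed.

Lemma toC0 : toC (0 : R) = 0.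
Proof. by []. Qed.

Lemma toC1 : toC (1 : R) = 1.
Proof. by []. Qed.

Lemma toC_nat (n : nat) : toC (n%:R : R) = n%:R.
Proof. exact: (rmorph_nat (real_complex R)). Qed.

Lemma toC_sum (I : Type) (r : seq I) (P : pred I) (F : I -> R) :
  toC (\sum_(i <- r | P i) F i) = \sum_(i <- r | P i) toC (F i).
Proof. exact: (rmorph_sum (real_complex R)). Qed.

Lemma toC_le (x y : R) : (toC x <= toC y) = (x <= y).
Proof. exact: lecR. Qed.

Lemma toC_ge0 (x : R) : (0 <= toC x) = (0 <= x).
Proof. exact: ler0c. Qed.

Lemma toC_inj : injective (@toC R).
Proof. exact: complexI. Qed.

Lemma toC_norm (x : R) : 0 <= x -> `|toC x| = toC x.
Proof. by move=> x0; rewrite ger0_norm // toC_ge0. Qed.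

Lemma toC_Re (z : C) : z \is Num.real -> toC (complex.Re z) = z.
Proof. exact: RRe_real. Qed.

Lemma toC_cabs (z : C) : toC (cabs z) = `|z|.
Proof. exact/toC_Re/normr_real. Qed.

Lemma cabs_ge0 (z : C) : 0 <= cabs z.
Proof. by rewrite -toC_ge0 toC_cabs. Qed.

Lemma norm_le_sqrtC (z w : C) : `|z| ^+ 2 <= w -> `|z| <= sqrtC w.
Proof.
move=> h; have w0 : 0 <= w by apply: le_trans h; rewrite exprn_ge0.
by rewrite -(@ler_pXn2r _ 2) ?nnegrE ?sqrtC_ge0 ?sqrtCK.
Qed.

End ComplexScalars.

(** * Adjoints and the Hilbert-Schmidt form *)

Section Dagger.
Variable R : realType.
Local Notation C := R[i].

Lemma dagE m n (A : 'M[C]_(m, n)) i j : dag A i j = (A j i)^*.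
Proof. by rewrite !mxE. Qed.

Lemma dagK m n (A : 'M[C]_(m, n)) : dag (dag A) = A.
Proof. by apply/matrixP => i j; rewrite !dagE conjCK. Qed.

Lemma dagM m n p (A : 'M[C]_(m, n)) (B : 'M[C]_(n, p)) :
  dag (A *m B) = dag B *m dag A.
Proof. by rewrite /dag map_mxM trmx_mul. Qed.

Lemma dagB m n (A B : 'M[C]_(m, n)) : dag (A - B) = dag A - dag B.
Proof. by apply/matrixP => i j; rewrite !mxE rmorphB. Qed.

Lemma dag1 n : dag (1%:M : 'M[C]_n) = 1%:M.
Proof. by rewrite /dag map_mx1 trmx1. Qed.

Lemma dag_diag n (d : 'rV[C]_n) :
  dag (diag_mx d) = diag_mx (map_mx Num.conj d).
Proof. by rewrite /dag map_diag_mx tr_diag_mx. Qed.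

Lemma dag_adjoint m n (A : 'M[C]_(m, n)) : dag A = (A ^t Num.conj)%sesqui.
Proof. by rewrite /dag map_trmx. Qed.

Lemma hsE m (A B : 'M[C]_m) : hs A B = \sum_i \sum_j (A i j)^* * B i j.
Proof.
rewrite /hs /mxtrace exchange_big /=; apply: eq_bigr => j _.
by rewrite !mxE; apply: eq_bigr => i _; rewrite !mxE.
Qed.

Lemma hsBr m (A B B' : 'M[C]_m) : hs A (B - B') = hs A B - hs A B'.
Proof. by rewrite /hs mulmxBr raddfB. Qed.

Lemma hsZr m c (A B : 'M[C]_m) : hs A (c *: B) = c * hs A B.
Proof. by rewrite /hs -scalemxAr mxtraceZ. Qed.

Lemma hsNl m (A B : 'M[C]_m) : hs (- A) B = - hs A B.
Proof. by rewrite /hs /dag map_mxN raddfN mulNmx raddfN. Qed.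

Lemma hs_sumr m (I : Type) (r : seq I) (P : pred I) (A : 'M[C]_m) F :
  hs A (\sum_(i <- r | P i) F i) = \sum_(i <- r | P i) hs A (F i).
Proof. by rewrite /hs mulmx_sumr raddf_sum. Qed.

Lemma hs_conj m (A B : 'M[C]_m) : (hs A B)^* = hs B A.
Proof.
rewrite !hsE rmorph_sum; apply: eq_bigr => i _.
rewrite rmorph_sum; apply: eq_bigr => j _.
by rewrite rmorphM /= conjCK mulrC.
Qed.

Lemma hs_ge0 m (A : 'M[C]_m) : 0 <= hs A A.
Proof.
rewrite hsE; apply: sumr_ge0 => i _; apply: sumr_ge0 => j _.
by rewrite mulrC -normCK exprn_ge0.
Qed.

End Dagger.

(** * Contractions and the trace norm *)

Section Contraction.
Variable R : realType.
Local Notation C := R[i].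

Definition sqnorm m (y : 'cV[C]_m) : C := \sum_i `|y i 0| ^+ 2.

Lemma sqnormE m (y : 'cV[C]_m) : sqnorm y = (dag y *m y) 0 0.
Proof. by rewrite mxE; apply: eq_bigr => i _; rewrite dagE normCK mulrC. Qed.

Lemma sqnorm_ge0 m (y : 'cV[C]_m) : 0 <= sqnorm y.
Proof. by apply: sumr_ge0 => i _; rewrite exprn_ge0. Qed.

Lemma coord_le_sqnorm m (y : 'cV[C]_m) i : `|y i 0| ^+ 2 <= sqnorm y.
Proof.
rewrite /sqnorm (bigD1 i) //= lerDl.
by apply: sumr_ge0 => j _; rewrite exprn_ge0.
Qed.

(** Operator norm at most one, phrased with squared lengths so that no operator norm has to be
    introduced. *)
Definition contraction m (V : 'M[C]_m) :=
  forall y : 'cV[C]_m, sqnorm (V *m y) <= sqnorm y.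

Lemma isometry_contraction m (V : 'M[C]_m) :
  dag V *m V = 1%:M -> contraction V.
Proof.
by move=> h y; rewrite !sqnormE dagM mulmxA -(mulmxA (dag y)) h mulmx1.
Qed.

Lemma contractionM m (V W : 'M[C]_m) :
  contraction V -> contraction W -> contraction (V *m W).
Proof. by move=> hV hW y; rewrite -mulmxA; apply: le_trans (hW y). Qed.

(** The hypothesis makes Q = W W^dagger an orthogonal projection, and |y|^2 - |W^dagger y|^2 = |(1 -
    Q) y|^2 is nonnegative. *)
Lemma coisometry_contraction m (W : 'M[C]_m) :
  W *m dag W *m (W *m dag W) = W *m dag W -> contraction (dag W).
Proof.
move=> h y; set Q := W *m dag W in h.
have hQ : dag Q = Q by rewrite /Q dagM dagK.
have := sqnorm_ge0 ((1%:M - Q) *m y).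
have -> : sqnorm ((1%:M - Q) *m y) = sqnorm y - sqnorm (dag W *m y); last first.
  by rewrite subr_ge0.
have idem : (1%:M - Q) *m (1%:M - Q) = 1%:M - Q.
  by rewrite mulmxBr mulmx1 mulmxBl mul1mx h subrr subr0.
rewrite !sqnormE !dagM dagK dagB dag1 hQ -!mulmxA (mulmxA (1%:M - Q)) idem.
by rewrite mulmxBl mul1mx mulmxBr mxE [X in _ + X]mxE /Q !mulmxA.
Qed.

Lemma contraction_entry m (V : 'M[C]_m) i j : contraction V -> `|V i j| <= 1.
Proof.
move=> hV; rewrite -(@ler_pXn2r _ 2) ?nnegrE // expr1n.
have := hV (delta_mx j 0); have := coord_le_sqnorm (V *m delta_mx j 0) i.
rewrite -colE mxE => h1 h2; apply: le_trans h1 (le_trans h2 _).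
rewrite /sqnorm (bigD1 j) //= big1 ?addr0 => [|k kj].
  by rewrite mxE !eqxx normr1 expr1n.
by rewrite mxE (negPf kj) normr0 expr0n.
Qed.

Lemma contraction_delta m (i j : 'I_m) : contraction (delta_mx i j).
Proof.
move=> y; have e k : (delta_mx i j *m y) k 0 = (k == i)%:R * y j 0.
  rewrite mxE (bigD1 j) //= big1 ?addr0 ?mxE ?eqxx ?andbT // => l lj.
  by rewrite mxE (negPf lj) andbF mul0r.
rewrite {1}/sqnorm (bigD1 i) //= big1 ?addr0 => [|k ki].
  by rewrite e eqxx mul1r coord_le_sqnorm.
by rewrite e (negPf ki) mul0r normr0 expr0n.
Qed.

End Contraction.

(** * Trace norm by duality, and positive semidefinite matrices *)

Section TraceNorm.
Variables (R : realType) (m : nat).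
Local Notation C := R[i].
Implicit Types (X V : 'M[C]_m).

Lemma hermitian_spectral X : dag X = X ->
  let P := spectralmx X in
  [/\ P *m dag P = 1%:M, dag P *m P = 1%:M &
      X = dag P *m diag_mx (spectral_diag X) *m P].
Proof.
move=> hX P.
have hP : P \is unitarymx := spectral_unitarymx X.
have e : P *m dag P = 1%:M by rewrite dag_adjoint; apply/unitarymxP.
split=> //; first exact: mulmx1C.
rewrite dag_adjoint -invmx_unitary //.
by apply/orthomx_spectralP/normalmxP; rewrite -dag_adjoint hX.
Qed.

Lemma gram_herm X : dag (dag X *m X) = dag X *m X.
Proof. by rewrite dagM dagK. Qed.

Local Notation P X := (spectralmx (dag X *m X)).
Local Notation mu X := (spectral_diag (dag X *m X)).
Local Notation Y X := (X *m dag (P X)).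

(** In an eigenbasis of X^dagger X the columns of X become orthogonal, and their squared lengths are
    the eigenvalues: a singular value decomposition without the left factor. *)
Lemma gram_polar X : dag (Y X) *m Y X = diag_mx (mu X).
Proof.
have [e1 e2 e3] := hermitian_spectral (gram_herm X).
rewrite dagM dagK mulmxA -(mulmxA (P X)) {2}e3 !mulmxA e1 mul1mx.
by rewrite -mulmxA e1 mulmx1.
Qed.

Lemma gram_eigenvalue X i : mu X 0 i = sqnorm (col i (Y X)).
Proof.
have := congr1 (fun A : 'M_m => A i i) (gram_polar X).
rewrite /sqnorm !mxE eqxx mulr1n => <-.
by apply: eq_bigr => k _; rewrite dagE !mxE normCK mulrC.
Qed.

Lemma gram_eigenvalue_ge0 X i : 0 <= mu X 0 i.
Proof. by rewrite gram_eigenvalue sqnorm_ge0. Qed.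

Lemma trnormE X : toC (trnorm X) = \sum_i sqrtC (mu X 0 i).
Proof.
apply/toC_Re/ger0_real/sumr_ge0 => i _.
by rewrite sqrtC_ge0 gram_eigenvalue_ge0.
Qed.

Lemma trnorm_ge0 X : 0 <= trnorm X.
Proof.
rewrite -toC_ge0 trnormE; apply: sumr_ge0 => i _.
by rewrite sqrtC_ge0 gram_eigenvalue_ge0.
Qed.

(** In the eigenbasis of X^dagger X, the i-th diagonal entry is a coordinate of a contraction
    applied to a column of length [sqrtC (mu X 0 i)]. *)
Lemma tr_contraction_le V X : contraction V -> `|\tr (V *m X)| <= toC (trnorm X).
Proof.
move=> hV; have [e1 e2 _] := hermitian_spectral (gram_herm X).
have -> : \tr (V *m X) = \tr (P X *m V *m Y X).
  by rewrite -[P X *m V *m _]mulmxA [RHS]mxtrace_mulC -!mulmxA e2 mulmx1.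
apply: le_trans (ler_norm_sum _ _ _) _; rewrite trnormE.
apply: ler_sum => i _; apply: norm_le_sqrtC; rewrite gram_eigenvalue.
have -> : (P X *m V *m Y X) i i = (P X *m V *m col i (Y X)) i 0.
  by rewrite [LHS]mxE [RHS]mxE; apply: eq_bigr => k _; rewrite [col _ _ _ _]mxE.
apply: le_trans (coord_le_sqnorm _ _) _.
apply: contractionM => //; exact: isometry_contraction.
Qed.

(* V is the adjoint of the partial isometry in the polar decomposition of X;
   0^-1 = 0 makes it vanish on the kernel of X. *)
Lemma trnorm_attained X :
  exists2 V, contraction V & \tr (V *m X) = toC (trnorm X).
Proof.
have [e1 e2 _] := hermitian_spectral (gram_herm X).
have mu0 := gram_eigenvalue_ge0 X; have gp := gram_polar X.
have XY : X = Y X *m P X by rewrite -mulmxA e2 mulmx1.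
rewrite trnormE; move: XY mu0 gp e1 e2; move: (Y X) => y.
move: (mu X) (P X) => u Q -> u0 gp e1 e2.
pose s := \row_i (sqrtC (u 0 i))^-1 : 'rV[C]_m.
have hs : dag (diag_mx s) = diag_mx s.
  rewrite dag_diag; congr diag_mx; apply/rowP => i; rewrite !mxE.
  by apply/CrealP; rewrite ger0_real // invr_ge0 sqrtC_ge0.
pose W := y *m diag_mx s.
have Wy : dag W *m y = diag_mx s *m diag_mx u by rewrite dagM hs -mulmxA gp.
(* With t = [sqrtC (u 0 i)], the diagonal entries of W^dagger W are t^-1 t^2 t^-1, that is 1, or 0
   when t = 0: the projection onto the support of [u]. *)
have WW : diag_mx s *m (dag W *m W) = diag_mx s.
  rewrite /W (mulmxA (dag W)) Wy !mulmxA !mulmx_diag.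
  congr diag_mx; apply/rowP => i; rewrite !mxE -(sqrtCK (u 0 i)) sqrCK ?sqrtC_ge0 //.
  set t := sqrtC _; have [->|t0] := eqVneq t 0; first by rewrite invr0 !mul0r.
  by rewrite expr2 !mulrA mulfVK // mulVf // mul1r.
have WK : W *m (dag W *m W) = W by rewrite {1}/W -mulmxA WW.
move: Wy WK; clearbody W => Wy WK.
exists (dag Q *m dag W).
  apply: contractionM.
    by apply: isometry_contraction; rewrite dagK.
  by apply: coisometry_contraction; rewrite -mulmxA (mulmxA (dag W)) mulmxA WK.
rewrite -mulmxA mxtrace_mulC -!mulmxA e1 mulmx1 Wy mulmx_diag.
apply: eq_bigr => i _; rewrite !mxE eqxx mulr1n -{2}(sqrtCK (u 0 i)).
set t := sqrtC _; have [->|t0] := eqVneq t 0; first by rewrite invr0 !mul0r.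
by rewrite expr2 mulrA mulVf ?mul1r.
Qed.

(** Together with [tr_contraction_le] this makes the trace norm a maximum of |Tr(V X)| over
    contractions V, from which homogeneity and the triangle inequality follow without spectral
    arguments. *)
Lemma trnorm_le_dual X (r : R) :
  (forall V, contraction V -> `|\tr (V *m X)| <= toC r) -> trnorm X <= r.
Proof.
move=> h; have [V cV e] := trnorm_attained X.
by move: (h V cV); rewrite e toC_norm ?trnorm_ge0 // toC_le.
Qed.

Lemma trnormZ c X : trnorm (c *: X) <= cabs c * trnorm X.
Proof.
apply: trnorm_le_dual => V hV; rewrite -scalemxAr mxtraceZ normrM toCM toC_cabs.
by apply: ler_wpM2l => //; apply: tr_contraction_le.
Qed.

Lemma trnorm_sum (I : Type) (r : seq I) (Q : pred I) (F : I -> 'M[C]_m) :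
  trnorm (\sum_(i <- r | Q i) F i) <= \sum_(i <- r | Q i) trnorm (F i).
Proof.
apply: trnorm_le_dual => V hV; rewrite mulmx_sumr raddf_sum toC_sum.
apply: le_trans (ler_norm_sum _ _ _) _; apply: ler_sum => i _.
exact: tr_contraction_le.
Qed.

(** The entry is Tr(E_ji X) for the matrix unit E_ji, a contraction. *)
Lemma entry_le_trnorm X i j : `|X i j| <= toC (trnorm X).
Proof.
have := tr_contraction_le X (contraction_delta j i).
congr (`|_| <= _); rewrite /mxtrace (bigD1 j) //= big1 ?addr0 => [|k kj].
  rewrite mxE (bigD1 i) //= big1 ?addr0 ?mxE ?eqxx ?mul1r // => l li.
  by rewrite mxE (negPf li) andbF mul0r.
by rewrite mxE big1 // => l _; rewrite mxE (negPf kj) mul0r.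
Qed.

(** A crude bound; it serves to show that the sets under [sup] are bounded above. *)
Lemma trnorm_le_entries X (b : R) :
  (forall i j, `|X i j| <= toC b) -> trnorm X <= (m * m)%:R * b.
Proof.
move=> h; apply: trnorm_le_dual => V hV.
apply: le_trans (ler_norm_sum _ _ _) _.
have -> : toC ((m * m)%:R * b) = \sum_(i < m) \sum_(j < m) toC b.
  rewrite -!toC_sum !sumr_const !card_ord; congr toC.
  by rewrite -mulrnA mulr_natl.
apply: ler_sum => i _; rewrite mxE; apply: le_trans (ler_norm_sum _ _ _) _.
apply: ler_sum => j _; rewrite normrM -[leRHS]mul1r.
by apply: ler_pM => //; apply: contraction_entry.
Qed.

Lemma psd_spectral X : psd X ->
  exists Q (l : 'rV[C]_m),
    [/\ Q *m dag Q = 1%:M, dag Q *m Q = 1%:M, X = dag Q *m diag_mx l *m Q,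
        forall i, 0 <= l 0 i & \tr X = \sum_i l 0 i].
Proof.
case=> hX pX; have [e1 e2 e3] := hermitian_spectral hX.
set Q := spectralmx X in e1 e2 e3; set l := spectral_diag X in e3.
exists Q, l; split=> // [i|]; last first.
  rewrite {1}e3 mxtrace_mulC mulmxA e1 mul1mx.
  by apply: eq_bigr => i _; rewrite mxE eqxx mulr1n.
(* The i-th eigenvalue is the quadratic form of X at the i-th row of Q, hence nonnegative. *)
have := pX (row i Q); rewrite {1}e3 !mulmxA.
have -> : row i Q *m dag Q = row i 1%:M by rewrite -row_mul e1.
have -> : row i 1%:M *m diag_mx l *m Q *m dag (row i Q)
          = row i 1%:M *m diag_mx l *m dag (row i 1%:M).
  by rewrite -e1 row_mul dagM dagK !mulmxA.
rewrite -!mulmxA mxE (bigD1 i) //= big1 ?addr0 => [|k ki].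
  rewrite mul_diag_mx !mxE eqxx !mulr1n conjC1 mulr1.
  by rewrite mul1r.
by rewrite mxE mxE eq_sym (negPf ki) mul0r.
Qed.

(** Tr(V X) is the sum of the eigenvalues weighted by the diagonal entries of the contraction Q V
    Q^dagger, each of modulus at most one. *)
Lemma psd_trnorm X : psd X -> toC (trnorm X) <= \tr X.
Proof.
move=> /psd_spectral[Q [l [e1 e2 e3 l0 trX]]].
have l1 : \sum_i l 0 i \is Num.real by apply/ger0_real/sumr_ge0.
rewrite trX -(toC_Re l1) toC_le; apply: trnorm_le_dual => V hV.
rewrite toC_Re // {1}e3 !mulmxA mxtrace_mulC !mulmxA.
apply: le_trans (ler_norm_sum _ _ _) _; apply: ler_sum => i _.
rewrite mul_mx_diag mxE normrM (ger0_norm (l0 i)) -[leRHS]mul1r.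
apply: ler_wpM2r => //; apply: contraction_entry.
apply: contractionM; last by apply: isometry_contraction; rewrite dagK.
by apply: contractionM => //; apply: isometry_contraction.
Qed.

(** For nonnegative eigenvalues the sum of squares is at most the square of the sum. For a state
    this says that the purity is at most one. *)
Lemma psd_hs X : psd X -> hs X X <= (\tr X) ^+ 2.
Proof.
move=> pX; have [hX _] := pX.
have [Q [l [e1 e2 e3 l0 trX]]] := psd_spectral pX.
have -> : hs X X = \sum_i l 0 i * l 0 i.
  rewrite /hs hX {1}e3 {1}e3 !mulmxA -(mulmxA _ Q (dag Q)) e1 mulmx1.
  rewrite mxtrace_mulC !mulmxA e1 mul1mx mulmx_diag.
  by apply: eq_bigr => i _; rewrite !mxE eqxx mulr1n.
rewrite expr2 {1}trX mulr_suml; apply: ler_sum => i _; apply: ler_wpM2l => //.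
by rewrite trX (bigD1 i) //= lerDl sumr_ge0.
Qed.

Lemma psd_entry X i j : psd X -> `|X i j| <= \tr X.
Proof. by move=> hX; apply: le_trans (entry_le_trnorm X i j) (psd_trnorm hX). Qed.

End TraceNorm.

(** * Superoperators and the diamond norm *)

Section Entries.
Variables (R : realType) (I : finType).
Local Notation C := R[i].
Implicit Types A B : fmx R I.

Lemma sum_enum_rank (F : 'I_#|I| -> C) : \sum_i F i = \sum_(i : I) F (enum_rank i).
Proof. by rewrite (reindex enum_rank) //=; apply: onW_bij; apply: enum_rank_bij. Qed.

(** Mostly rewritten from right to left, to insert a Kronecker delta that a completeness relation
    then matches. *)
Lemma sum_mul_eq (F : I -> C) j : \sum_(i : I) F i * (i == j)%:R = F j.
Proof.
rewrite (bigD1 j) //= eqxx mulr1 big1 ?addr0 // => i /negPf ->.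
by rewrite mulr0.
Qed.

Lemma ent_mkfmx (f : I -> I -> C) i j : ent (mkfmx f) i j = f i j.
Proof. by rewrite /ent mxE !enum_rankK. Qed.

Lemma entP A B : (forall i j, ent A i j = ent B i j) -> A = B.
Proof.
move=> h; apply/matrixP => i j.
by have := h (enum_val i) (enum_val j); rewrite /ent !enum_valK.
Qed.

Lemma entM A B i j : ent (A *m B) i j = \sum_k ent A i k * ent B k j.
Proof. by rewrite /ent mxE sum_enum_rank. Qed.

Lemma entD A B i j : ent (A + B) i j = ent A i j + ent B i j.
Proof. by rewrite /ent mxE. Qed.

Lemma entN A i j : ent (- A) i j = - ent A i j.
Proof. by rewrite /ent mxE. Qed.

Lemma entZ c A i j : ent (c *: A) i j = c * ent A i j.
Proof. by rewrite /ent mxE. Qed.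

Lemma ent_sum (K : Type) (r : seq K) (P : pred K) (F : K -> fmx R I) i j :
  ent (\sum_(k <- r | P k) F k) i j = \sum_(k <- r | P k) ent (F k) i j.
Proof. by rewrite /ent summxE. Qed.

Lemma ent_dag A i j : ent (dag A) i j = (ent A j i)^*.
Proof. by rewrite /ent dagE. Qed.

Lemma ent1 i j : ent (1%:M : fmx R I) i j = (i == j)%:R.
Proof. by rewrite /ent mxE (inj_eq enum_rank_inj). Qed.

Lemma tr_ent A : \tr A = \sum_i ent A i i.
Proof. by rewrite /mxtrace sum_enum_rank. Qed.

Lemma hs_ent A B : hs A B = \sum_i \sum_j (ent A i j)^* * ent B i j.
Proof.
by rewrite hsE sum_enum_rank; apply: eq_bigr => i _; rewrite sum_enum_rank.
Qed.

Lemma quad_ent A (w : 'rV[C]_#|I|) :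
  (w *m A *m dag w) 0 0 =
  \sum_i \sum_j w 0 (enum_rank i) * ent A i j * (w 0 (enum_rank j))^*.
Proof.
rewrite mxE sum_enum_rank exchange_big; apply: eq_bigr => j _ /=.
rewrite dagE mxE mulr_suml sum_enum_rank; apply: eq_bigr => i _.
by [].
Qed.

(** The quadratic form at w is |t|^2 with t the sum of the products w_i v_i. *)
Lemma psd_mkfmx_rank1 (v : I -> C) : psd (mkfmx (fun i j => v i * (v j)^*)).
Proof.
split=> [|w].
  by apply: entP => i j; rewrite ent_dag !ent_mkfmx rmorphM /= conjCK mulrC.
rewrite quad_ent; set t := \sum_i w 0 (enum_rank i) * v i.
suff -> : \sum_i \sum_j w 0 (enum_rank i) *
    ent (mkfmx (fun i j => v i * (v j)^*)) i j * (w 0 (enum_rank j))^* = t * t^*.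
  by rewrite -normCK exprn_ge0.
rewrite /t mulr_suml; apply: eq_bigr => i _.
rewrite rmorph_sum mulr_sumr; apply: eq_bigr => j _.
by rewrite ent_mkfmx rmorphM /= mulrA mulrAC -!mulrA.
Qed.

Definition unit_fmx (k l : I) : fmx R I :=
  mkfmx (fun i j => (i == k)%:R * (j == l)%:R).

Lemma fmx_unit_sum A : A = \sum_k \sum_l ent A k l *: unit_fmx k l.
Proof.
apply: entP => i j; rewrite ent_sum.
rewrite -[LHS](sum_mul_eq (fun k => ent A k j)) ; apply: eq_bigr => k _.
rewrite ent_sum -[X in X * _](sum_mul_eq (fun l => ent A k l)) mulr_suml.
apply: eq_bigr => l _; rewrite entZ ent_mkfmx (eq_sym k) (eq_sym l).
by rewrite -mulrA (mulrC (j == l)%:R).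
Qed.

End Entries.

Lemma sum_pair_mul_eq (R : realType) (I J : finType) (F : I * J -> R[i]) j :
  \sum_p F p * (p.2 == j)%:R = \sum_i F (i, j).
Proof.
rewrite (eq_bigr (fun p : I * J => F (p.1, p.2) * (p.2 == j)%:R)); last by case.
rewrite -(pair_bigA _ (fun a b => F (a, b) * (b == j)%:R)) /=.
by apply: eq_bigr => i _; rewrite (sum_mul_eq (fun b => F (i, b))).
Qed.

Section Superoperators.
Variables (R : realType) (I : finType).
Local Notation C := R[i].
Implicit Types (Phi : fmx R I -> fmx R I) (A B : fmx R I).

Section Linear.
Variables (Phi : fmx R I -> fmx R I) (linPhi : linear_so Phi).

Lemma linear_so0 : Phi 0 = 0.
Proof.
have := linPhi 1 0 0; rewrite !scale1r addr0 => /(congr1 (fun Z => Z - Phi 0)).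
by rewrite subrr addrK => <-.
Qed.

Lemma linear_soD A B : Phi (A + B) = Phi A + Phi B.
Proof. by have := linPhi 1 A B; rewrite !scale1r. Qed.

Lemma linear_soZ c A : Phi (c *: A) = c *: Phi A.
Proof. by have := linPhi c A 0; rewrite linear_so0 !addr0. Qed.

Lemma linear_so_sum (K : Type) (r : seq K) (P : pred K) (F : K -> fmx R I) :
  Phi (\sum_(k <- r | P k) F k) = \sum_(k <- r | P k) Phi (F k).
Proof.
apply: (big_morph Phi) => [x y|]; [exact: linear_soD | exact: linear_so0].
Qed.

Lemma id_minus_linear : linear_so (id_minus Phi).
Proof.
move=> c X Y; rewrite /id_minus linPhi scalerBr opprD !addrA.
by congr (_ - _); rewrite addrAC.
Qed.

End Linear.

Definition block (J : finType) (X : fmx R (I * J)%type) (j j' : J) : fmx R I :=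
  mkfmx (fun i i' => ent X (i, j) (i', j')).

Lemma ent_ext_so (J : finType) Phi (X : fmx R (I * J)%type) p q :
  ent (ext_so Phi X) p q = ent (Phi (block X p.2 q.2)) p.1 q.1.
Proof. by rewrite ent_mkfmx. Qed.

Lemma tr_block (J : finType) (X : fmx R (I * J)%type) :
  \tr X = \sum_j \tr (block X j j).
Proof.
rewrite tr_ent (eq_bigr (fun p : I * J => ent X (p.1, p.2) (p.1, p.2))); last first.
  by case.
rewrite -(pair_bigA _ (fun i j => ent X (i, j) (i, j))) /= exchange_big.
by apply: eq_bigr => j _; rewrite tr_ent; apply: eq_bigr => i _; rewrite ent_mkfmx.
Qed.

Lemma block_ext_so (J : finType) Phi (X : fmx R (I * J)%type) j j' :
  block (ext_so Phi X) j j' = Phi (block X j j').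
Proof. by apply: entP => i i'; rewrite ent_mkfmx ent_ext_so. Qed.

(** Each block of X is expanded in matrix units; its coefficients are entries of X, hence bounded by
    the trace norm of X. *)
Lemma trnorm_ext_so_le (J : finType) Phi (b : R) (X : fmx R (I * J)%type) :
  linear_so Phi ->
  (forall k l i j, `|ent (Phi (unit_fmx R k l)) i j| <= toC b) ->
  trnorm X <= 1 ->
  trnorm (ext_so Phi X) <=
    (#|{: I * J}| * #|{: I * J}|)%:R * ((#|I| * #|I|)%:R * b).
Proof.
move=> linPhi hb hX; apply: trnorm_le_entries => i j.
rewrite -(enum_valK i) -(enum_valK j) -[X in `|X|]/(ent _ _ _) ent_ext_so.
move: (enum_val i) (enum_val j) => [i1 i2] [j1 j2] /=.
rewrite [block _ _ _]fmx_unit_sum linear_so_sum // ent_sum.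
have -> : toC ((#|I| * #|I|)%:R * b) = \sum_(k : I) \sum_(l : I) toC b.
  by rewrite -!toC_sum !sumr_const; congr toC; rewrite -mulrnA mulr_natl.
apply: le_trans (ler_norm_sum _ _ _) _; apply: ler_sum => k _.
rewrite linear_so_sum // ent_sum.
apply: le_trans (ler_norm_sum _ _ _) _; apply: ler_sum => l _.
rewrite linear_soZ // entZ normrM -[leRHS]mul1r ent_mkfmx.
apply: ler_pM => //; apply: le_trans (entry_le_trnorm _ _ _) _.
by rewrite -toC1 toC_le.
Qed.

Lemma dnorm_le Phi (r : R) :
  (forall X : fmx R (I * I)%type, trnorm X <= 1 -> trnorm (ext_so Phi X) <= r) ->
  dnorm Phi <= r.
Proof.
move=> h; apply: ge_sup => [|_ [X [hX ->]]]; last exact: h.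
(* [ge_sup] asks for a nonempty set; the zero operator provides an element. *)
exists (trnorm (ext_so Phi (0 : fmx R (I * I)%type))), 0.
split=> //; apply: trnorm_le_dual => V _.
by rewrite mulmx0 linear0 normr0 toC1 ler01.
Qed.

(** The point is that the set defining [dnorm] is bounded above, which linearity gives in finite
    dimension. *)
Lemma le_dnorm Phi (X : fmx R (I * I)%type) :
  linear_so Phi -> trnorm X <= 1 -> trnorm (ext_so Phi X) <= dnorm Phi.
Proof.
move=> linPhi hX; apply: ub_le_sup; last by exists X.
(* The sum of all moduli dominates each single one and avoids a maximum. *)
pose b : R := \sum_k \sum_l \sum_i \sum_j cabs (ent (Phi (unit_fmx R k l)) i j).
exists ((#|{: I * I}| * #|{: I * I}|)%:R * ((#|I| * #|I|)%:R * b)).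
move=> _ [Y [hY ->]]; apply: trnorm_ext_so_le => // k l i j.
rewrite -toC_cabs toC_le /b (bigD1 k) //= (bigD1 l) //= (bigD1 i) //= (bigD1 j) //=.
have h0 (K : finType) (P : pred K) (F : K -> R) : (forall x, 0 <= F x) ->
  0 <= \sum_(x | P x) F x by move=> hF; apply: sumr_ge0.
by rewrite -!addrA lerDl !addr_ge0 ?h0 // => *; rewrite ?h0 // => *;
  rewrite ?h0 // => *; rewrite ?h0 // => *; apply: cabs_ge0.
Qed.

Lemma dnorm_ge0 Phi : linear_so Phi -> 0 <= dnorm Phi.
Proof.
move=> linPhi; apply: le_trans (trnorm_ge0 _) (le_dnorm (X := 0) linPhi _).
by apply: trnorm_le_dual => V _; rewrite mulmx0 linear0 normr0 toC1 ler01.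
Qed.

(* The rank-one matrix v v^* with v = e_k (x) f_0 + e_l (x) f_1 has [unit_fmx k l]
   as off-diagonal block, so 2-positivity bounds the entries of its image by the
   trace of v v^*. *)
Lemma channel_entry_le Phi k l i j :
  channel Phi -> `|ent (Phi (unit_fmx R k l)) i j| <= toC 2.
Proof.
case=> _ cpPhi tpPhi.
pose v (p : I * 'I_2) : C := ((p == (k, ord0)) || (p == (l, ord_max)))%:R.
pose X := mkfmx (fun p q : I * 'I_2 => v p * (v q)^*).
have <- : block X ord0 ord_max = unit_fmx R k l.
  apply: entP => a b; rewrite !ent_mkfmx /v conjC_nat !xpair_eqE !eqxx /=.
  by rewrite !andbT !andbF orbF.
rewrite -(ent_ext_so Phi X (i, ord0) (j, ord_max)).
apply: le_trans (psd_entry _ _ (cpPhi _ _ (psd_mkfmx_rank1 v))) _.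
rewrite tr_block (eq_bigr (fun j => \tr (block X j j))); last first.
  by move=> s _; rewrite block_ext_so tpPhi.
rewrite -tr_block tr_ent.
rewrite (eq_bigr (fun p => (p == (k, ord0))%:R + (p == (l, ord_max))%:R)); last first.
  move=> p _; rewrite ent_mkfmx /v conjC_nat -natrM mulnb andbb -natrD.
  case: (p =P (k, ord0)) => [->|_]; last by [].
  by rewrite xpair_eqE andbF.
have sum1 x : \sum_(p : I * 'I_2) (p == x)%:R = 1 :> C.
  rewrite -[RHS](sum_mul_eq (fun=> 1 : C) x).
  by apply: eq_bigr => p _; rewrite mul1r.
by rewrite big_split /= !sum1 toC_nat.
Qed.

(** The bound is uniform in the channel, so the supremum over the Clifford group in the theorem is
    over a bounded set, with no appeal to finiteness of the group. *)
Lemma channel_dnorm_bounded : exists M : R,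
  forall Phi, channel Phi -> dnorm (id_minus Phi) <= M.
Proof.
(* In 1 + 2, the 1 bounds the entries of a matrix unit and the 2 those of its image under a
   channel. *)
exists ((#|{: I * I}| * #|{: I * I}|)%:R * ((#|I| * #|I|)%:R * (1 + 2))).
move=> Phi cPhi; have [linPhi _ _] := cPhi; apply: dnorm_le => X hX.
apply: trnorm_ext_so_le => //; first exact: id_minus_linear.
move=> k l i j; rewrite /id_minus entD entN toCD.
apply: le_trans (ler_normB _ _) _; apply: lerD; last exact: channel_entry_le.
rewrite ent_mkfmx toC1 -natrM ger0_norm ?ler0n // (ler_nat _ _ 1) mulnb.
exact: leq_b1.
Qed.

(** The diamond norm uses an ancilla, so rho is padded to rho (x) |j0><j0| and U to U (x) 1. The
    trace is unchanged, and duality with the unitary U (x) 1 gives the bound. *)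
Lemma tr_unitary_le_dnorm Phi (U rho : fmx R I) (j0 : I) :
  linear_so Phi -> dag U *m U = 1%:M -> qstate rho ->
  `|\tr (U *m Phi rho)| <= toC (dnorm Phi).
Proof.
move=> linPhi hU [[hrho prho] trrho].
pose X := mkfmx (fun p q : I * I =>
  ent rho p.1 q.1 * (p.2 == j0)%:R * (q.2 == j0)%:R).
have bX j j' : block X j j' = ((j == j0)%:R * (j' == j0)%:R) *: rho.
  by apply: entP => a b; rewrite entZ !ent_mkfmx /= -mulrA mulrC.
have pX : psd X.
  split=> [|w].
    apply: entP => p q; rewrite ent_dag !ent_mkfmx !rmorphM /= !conjC_nat.
    by rewrite -ent_dag hrho mulrAC.
  (* The quadratic form of X at [w] is that of rho at the slice of [w] with ancilla index [j0]. *)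
  pose w' : 'rV[C]_#|I| := \row_i w 0 (enum_rank (enum_val i, j0)).
  have := prho w'; rewrite !quad_ent; congr (0 <= _).
  have w'E k : w' 0 (enum_rank k) = w 0 (enum_rank (k, j0)).
    by rewrite mxE enum_rankK.
  pose F (p q : I * I) :=
    w 0 (enum_rank p) * ent rho p.1 q.1 * (w 0 (enum_rank q))^*.
  transitivity (\sum_p (\sum_q F p q * (q.2 == j0)%:R) * (p.2 == j0)%:R).
    rewrite (sum_pair_mul_eq (fun p => \sum_q F p q * (q.2 == j0)%:R)).
    apply: eq_bigr => i _; rewrite (sum_pair_mul_eq (F (i, j0))).
    by apply: eq_bigr => j _; rewrite !w'E.
  apply: eq_bigr => p _; rewrite mulr_suml; apply: eq_bigr => q _.
  by rewrite /F ent_mkfmx; ring.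
have trX : trnorm X <= 1.
  rewrite -toC_le; apply: le_trans (psd_trnorm pX) _.
  rewrite tr_block (eq_bigr (fun j => (j == j0)%:R * (j == j0)%:R)) => [|j _].
    by rewrite sum_mul_eq eqxx.
  by rewrite bX mxtraceZ trrho mulr1.
pose V := mkfmx (fun p q : I * I => ent U p.1 q.1 * (p.2 == q.2)%:R).
have sumV (F : I * I -> C) p : \sum_q ent V p q * F q =
    \sum_q1 ent U p.1 q1 * F (q1, p.2).
  rewrite (eq_bigr (fun q : I * I => (fun q1 q2 =>
    ent U p.1 q1 * (p.2 == q2)%:R * F (q1, q2)) q.1 q.2)); last first.
    by case=> q1 q2 _; rewrite ent_mkfmx.
  rewrite -(pair_bigA _ (fun q1 q2 => ent U p.1 q1 * (p.2 == q2)%:R * F (q1, q2))).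
  apply: eq_bigr => q1 _ /=.
  rewrite -[RHS](sum_mul_eq (fun q2 => ent U p.1 q1 * F (q1, q2))).
  by apply: eq_bigr => q2 _; rewrite mulrAC (eq_sym p.2).
have UU : U *m dag U = 1%:M by exact: mulmx1C.
have hV : dag V *m V = 1%:M.
  (* The goal is turned into V V^dagger = 1, where [sumV] applies directly. *)
  apply: mulmx1C; apply: entP => p q; rewrite entM sumV ent1.
  under eq_bigr => i _ do rewrite ent_dag ent_mkfmx rmorphM /= conjC_nat -ent_dag mulrA.
  rewrite -mulr_suml -entM UU ent1 -natrM mulnb; case: p q => [p1 p2] [q1 q2].
  by rewrite xpair_eqE /= (eq_sym q2).
have -> : \tr (U *m Phi rho) = \tr (V *m ext_so Phi X).
  rewrite [RHS]tr_ent; under [RHS]eq_bigr => p _ do rewrite entM sumV.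
  rewrite (eq_bigr (fun p : I * I =>
    ent (U *m Phi rho) p.1 p.1 * (p.2 == j0)%:R)); last first.
    move=> p _; rewrite entM mulr_suml; apply: eq_bigr => q _.
    rewrite ent_ext_so bX linear_soZ // entZ /= -natrM mulnb andbb.
    by rewrite mulrCA mulrC.
  by rewrite (sum_pair_mul_eq (fun p => ent (U *m Phi rho) p.1 p.1)) tr_ent.
apply: le_trans (tr_contraction_le _ (isometry_contraction hV)) _.
by rewrite toC_le; apply: le_dnorm.
Qed.

End Superoperators.

(** * Pauli and Clifford operators *)

Lemma mulCii (R : realType) : 'i * 'i = -1 :> R[i].
Proof. by rewrite -expr2 sqrCi. Qed.

Definition simpC (R : realType) :=
  (@mulr0 R[i], @mul0r R[i], @addr0 R[i], @add0r R[i], @mulr1 R[i], @mul1r R[i],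
   @oppr0 R[i], @opprK R[i], @mulrN R[i], @mulNr R[i], @subrr R[i], @addNr R[i],
   mulCii R, @conjC0 R[i], @conjC1 R[i], @conjCi R[i], @expr0 R[i], @expr1 R[i]).

Section Pauli.
Variables (R : realType) (n : nat).
Local Notation C := R[i].

(** The tensor product of one 2 x 2 matrix per qubit; it reduces Pauli identities to single-qubit
    case checks. *)
Definition tens (f : 'I_n -> bool -> bool -> C) : Op R n :=
  mkfmx (fun x y : qb n => \prod_(i < n) f i (x i) (y i)).

Lemma prod_eq_ffun (T : finType) (x y : {ffun 'I_n -> T}) :
  \prod_(i < n) (x i == y i)%:R = (x == y)%:R :> C.
Proof.
have [->|xy] := eqVneq x y; first by rewrite big1 // => i _; rewrite eqxx.
have [i xyi] : exists i, x i != y i.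
  apply/existsP; rewrite -negb_forall; apply: contraNN xy => /forallP h.
  by apply/eqP/ffunP => i; apply/eqP.
by rewrite (bigD1 i) //= (negPf xyi) mul0r.
Qed.

Lemma eq_tens f g : (forall i x y, f i x y = g i x y) -> tens f = tens g.
Proof.
move=> h; apply: entP => x y; rewrite !ent_mkfmx.
by apply: eq_bigr => i _; rewrite h.
Qed.

(** A product over qubits of sums over bits is a sum over bit strings of products. *)
Lemma tensM f g :
  tens f *m tens g = tens (fun i x z => \sum_y f i x y * g i y z).
Proof.
apply: entP => x z; rewrite entM ent_mkfmx bigA_distr_bigA /=.
by apply: eq_bigr => y _; rewrite !ent_mkfmx -big_split.
Qed.

Lemma tens_dag f : dag (tens f) = tens (fun i x y => (f i y x)^*).
Proof. by apply: entP => x y; rewrite ent_dag !ent_mkfmx rmorph_prod. Qed.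

Lemma tens1 : tens (fun i x y => (x == y)%:R) = 1%:M.
Proof. by apply: entP => x y; rewrite ent_mkfmx ent1 prod_eq_ffun. Qed.

Lemma pauli1_herm b x y : (pauli1 b y x : C)^* = pauli1 b x y.
Proof.
by case: b => [[] []]; case: x; case: y; rewrite /= ?conjC0 ?conjC1 ?rmorphN //=
  ?conjCi ?conjC1 ?opprK.
Qed.

Lemma pauli1_sq b x z : \sum_y pauli1 b x y * pauli1 b y z = (x == z)%:R :> C.
Proof.
by rewrite big_bool; case: b => [[] []]; case: x; case: z;
  rewrite /= ?xpair_eqE /= ?simpC //.
Qed.

Lemma pauli1_orth a b :
  \sum_x \sum_y (pauli1 a x y)^* * pauli1 b x y = 2 * (a == b)%:R :> C.
Proof.
under eq_bigr => x _ do under eq_bigr => y _ do rewrite pauli1_herm.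
rewrite !big_bool; case: a => [[] []]; case: b => [[] []];
  rewrite /= ?xpair_eqE /= ?simpC //.
Qed.

(** Completeness relation: the four Pauli matrices form an orthogonal basis of the 2 x 2
    matrices. *)
Lemma pauli1_complete x y u v :
  \sum_a (pauli1 a x y)^* * pauli1 a u v = 2 * ((u == x)%:R * (v == y)%:R) :> C.
Proof.
rewrite (eq_bigr (fun a : bool * bool =>
  pauli1 (a.1, a.2) y x * pauli1 (a.1, a.2) u v)); last first.
  by move=> [b c] _; rewrite pauli1_herm.
rewrite -(pair_bigA _ (fun b c => pauli1 (b, c) y x * pauli1 (b, c) u v)) /=.
rewrite !big_bool; case: x; case: y; case: u; case: v;
  rewrite /= ?xpair_eqE /= ?simpC //.
Qed.

(** The analogue for 1 and Z alone, which span only the diagonal matrices: the right side is 2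
    exactly when all four indices agree. *)
Lemma Zop1_complete x y u v :
  \sum_b (pauli1 (b, false) x y)^* * pauli1 (b, false) u v =
  2 * ((x == y)%:R * ((u == v)%:R * (x == u)%:R)) :> C.
Proof.
under eq_bigr => b _ do rewrite pauli1_herm.
rewrite !big_bool; case: x; case: y; case: u; case: v;
  rewrite /= ?xpair_eqE /= ?simpC //.
Qed.

Lemma pauliE (a : plab n) : pauli a = tens (fun i => pauli1 (a i)) :> Op R n.
Proof. by []. Qed.

Lemma pauli_herm (a : plab n) : dag (pauli a) = pauli a :> Op R n.
Proof.
by rewrite pauliE tens_dag; apply: eq_tens => i x y; rewrite pauli1_herm.
Qed.

Lemma pauli_sq (a : plab n) : pauli a *m pauli a = 1%:M :> Op R n.
Proof.
by rewrite pauliE tensM -tens1; apply: eq_tens => i x y; rewrite pauli1_sq.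
Qed.

Lemma prod_const (c : C) : \prod_(i < n) c = c ^+ n.
Proof. by rewrite prodr_const card_ord. Qed.

Lemma pauli_orth (a b : plab n) :
  hs (pauli a : Op R n) (pauli b) = (2 ^ n)%:R * (a == b)%:R :> C.
Proof.
rewrite hs_ent natrX -prod_const -prod_eq_ffun -big_split /=.
under [RHS]eq_bigr => i _ do rewrite -pauli1_orth.
rewrite bigA_distr_bigA; apply: eq_bigr => x _ /=.
rewrite bigA_distr_bigA; apply: eq_bigr => y _ /=.
by rewrite !ent_mkfmx rmorph_prod -big_split.
Qed.

Lemma natr2n_neq0 (F : numDomainType) : (2 ^ n)%:R != 0 :> F.
Proof. by rewrite pnatr_eq0 expn_eq0. Qed.

Lemma pauli_neq0 (a : plab n) : pauli a != 0 :> Op R n.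
Proof.
apply/eqP => h; have := pauli_orth a a.
rewrite {2}h /hs mulmx0 mxtrace0 eqxx mulr1 => /esym/eqP.
by rewrite (negPf (natr2n_neq0 _)).
Qed.

Lemma pauli_inj : injective (@pauli R n).
Proof.
move=> a b h; have := pauli_orth a b; rewrite -h pauli_orth eqxx.
move/(mulfI (natr2n_neq0 _)); case: eqP => // _ /eqP.
by rewrite eqr_nat.
Qed.

Lemma pauli_complete x y u v :
  \sum_a (ent (pauli a : Op R n) x y)^* * ent (pauli a) u v =
  (2 ^ n)%:R * ((u == x)%:R * (v == y)%:R) :> C.
Proof.
rewrite natrX -prod_const -!prod_eq_ffun -!big_split /=.
under [RHS]eq_bigr => i _ do rewrite -pauli1_complete.
rewrite bigA_distr_bigA; apply: eq_bigr => a _ /=.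
by rewrite !ent_mkfmx rmorph_prod -big_split.
Qed.

(** [pauli_complete] collapses the sum over labels to two Kronecker deltas, which are also inserted
    around the entry of X on the left. *)
Lemma pauli_expand (X : Op R n) :
  X = (2 ^ n)%:R^-1 *: \sum_a hs (pauli a) X *: pauli a.
Proof.
apply: entP => u v; rewrite entZ ent_sum.
apply: (mulfI (natr2n_neq0 _)); rewrite mulVKf ?natr2n_neq0 //.
under eq_bigr => a _ do rewrite entZ hs_ent mulr_suml.
rewrite exchange_big /= -[X in _ * X](sum_mul_eq (fun x => ent X x v)) mulr_sumr.
apply: eq_bigr => x _.
under eq_bigr => a _ do rewrite mulr_suml.
rewrite exchange_big /= -[X in _ * (X * _)](sum_mul_eq (fun y => ent X x y)).
rewrite mulr_suml mulr_sumr; apply: eq_bigr => y _.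
under eq_bigr => a _ do rewrite mulrAC.
rewrite -mulr_suml pauli_complete (eq_sym u x) (eq_sym v y).
ring.
Qed.

Lemma pauli_parseval (X X' : Op R n) :
  \sum_a hs X (pauli a) * hs (pauli a) X' = (2 ^ n)%:R * hs X X'.
Proof.
rewrite {2}(pauli_expand X') hsZr mulVKf ?natr2n_neq0 // hs_sumr.
by apply: eq_bigr => a _; rewrite hsZr mulrC.
Qed.

Lemma Zop_complete x y u v :
  \sum_z (ent (Zop z : Op R n) x y)^* * ent (Zop z) u v =
  (2 ^ n)%:R * ((x == y)%:R * ((u == v)%:R * (x == u)%:R)) :> C.
Proof.
rewrite natrX -prod_const -!prod_eq_ffun -!big_split /=.
under [RHS]eq_bigr => i _ do rewrite -Zop1_complete.
rewrite bigA_distr_bigA; apply: eq_bigr => z _ /=.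
rewrite !ent_mkfmx rmorph_prod -big_split.
by apply: eq_bigr => i _; rewrite !ffunE.
Qed.

Lemma hs_Eop x (X : Op R n) : hs (Eop x) X = ent X x x.
Proof.
rewrite hs_ent -[RHS](sum_mul_eq (fun y => ent X y x)); apply: eq_bigr => y _.
rewrite -[X in X * _](sum_mul_eq (fun w => ent X y w)) mulr_suml.
apply: eq_bigr => w _; rewrite ent_mkfmx conjC_nat -mulnb natrM.
by rewrite mulrC mulrA mulrAC.
Qed.

Lemma MsoE (X : Op R n) :
  Mso X = (2 ^ n)%:R^-1 *: \sum_z hs (Zop z) X *: Zop z.
Proof.
apply: entP => u v; rewrite entZ !ent_sum.
apply: (mulfI (natr2n_neq0 _)); rewrite mulVKf ?natr2n_neq0 //.
(* After multiplication by d, both sides are d times the entry of the diagonal part of X. *)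
transitivity ((2 ^ n)%:R * ((u == v)%:R * ent X u u)).
  congr (_ * _); rewrite -[RHS](sum_mul_eq (fun x => (u == v)%:R * ent X x x) u).
  apply: eq_bigr => x _; rewrite entZ hs_Eop ent_mkfmx -mulnb natrM.
  by have [->|_] := eqVneq x u; rewrite ?eqxx ?(eq_sym v u) /=; ring.
under [RHS]eq_bigr => a _ do rewrite entZ hs_ent mulr_suml.
rewrite exchange_big /= -(sum_mul_eq (fun x => (u == v)%:R * ent X x x)) mulr_sumr.
apply: eq_bigr => x _.
under [RHS]eq_bigr => a _ do rewrite mulr_suml.
rewrite exchange_big /= -(sum_mul_eq (fun y => (u == v)%:R * ent X x y) x).
rewrite mulr_suml mulr_sumr; apply: eq_bigr => y _.
under [RHS]eq_bigr => a _ do rewrite mulrAC.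
rewrite -mulr_suml Zop_complete (eq_sym x y).
ring.
Qed.

End Pauli.

(** * Clifford conjugation of Pauli operators *)

Section Clifford.
Variables (R : realType) (n : nat).
Local Notation C := R[i].

Definition maps_paulis (g : Op R n) := forall a : plab n,
  exists b : plab n, dag g *m pauli a *m g = pauli b \/
                     dag g *m pauli a *m g = - pauli b.

Lemma maps_paulis_sign (g : Op R n) (a b : plab n) (s : bool) :
  (forall x y, ent (dag g *m pauli a *m g) x y = (-1) ^+ s * ent (pauli b) x y) ->
  exists b' : plab n, dag g *m pauli a *m g = pauli b' \/
                      dag g *m pauli a *m g = - pauli b'.
Proof.
move=> h; exists b; case: s h => h; [right|left]; apply: entP => x y; rewrite h.
  by rewrite entN expr1 mulN1r.
by rewrite mul1r.
Qed.

Definition local_op (i : 'I_n) (h : bool -> bool -> C) : Op R n :=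
  tens (fun j x y => if j == i then h x y else (x == y)%:R).

(** Tensor factors away from qubit i are conjugated by the identity, so a check on one qubit
    suffices. *)
Lemma local_op_maps_paulis i h :
  (forall b, exists b' (s : bool), forall x y,
    \sum_v (\sum_u (h u x)^* * pauli1 b u v) * h v y = (-1) ^+ s * pauli1 b' x y) ->
  maps_paulis (local_op i h).
Proof.
move=> hh a; have [b' [s hs]] := hh (a i).
apply: (@maps_paulis_sign _ _ [ffun j => if j == i then b' else a j] s) => x y.
rewrite /local_op !pauliE tens_dag !tensM !ent_mkfmx (bigD1 i) //= eqxx hs.
rewrite [in RHS](bigD1 i) //= ffunE eqxx mulrA; congr (_ * _).
apply: eq_bigr => j /negPf ji; rewrite ffunE ji.
under eq_bigr => v _.
  under eq_bigr => u _ do rewrite conjC_nat mulrC.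
  rewrite sum_mul_eq; over.
by rewrite sum_mul_eq.
Qed.

Lemma prod_local i (x y : qb n) (c : C) :
  \prod_(j < n) (if j == i then c else (x j == y j)%:R) =
  ([forall j, (j != i) ==> (x j == y j)])%:R * c.
Proof.
rewrite (bigD1 i) //= eqxx mulrC; congr (_ * _).
case: forallP => [h|/forallP].
  by rewrite big1 // => j ji; rewrite (negPf ji) (implyP (h j)).
rewrite negb_forall => /existsP[j]; rewrite negb_imply => /andP[ji xyj].
by rewrite (bigD1 j) //= (negPf ji) (negPf xyj) mul0r.
Qed.

Lemma hadamardE i :
  hadamard i = local_op i (fun x y => (if x && y then -1 else 1) / sqrtC 2).
Proof.
apply: entP => x y; rewrite !ent_mkfmx -mulrA -prod_local.
by apply: eq_bigr => j _; case: eqP => // ->.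
Qed.

Lemma phaseE i :
  phase i = local_op i (fun x y => (x == y)%:R * (if x then 'i else 1)).
Proof.
apply: entP => x y; rewrite !ent_mkfmx.
rewrite (eq_bigr (fun j => if j == i then (x i == y i)%:R * (if x i then 'i else 1)
  else (x j == y j)%:R)); last by move=> j _; case: eqP => // ->.
rewrite prod_local mulrA -natrM mulnb; congr (_%:R * _); congr nat_of_bool.
apply/eqP/andP => [->|[/forallP h /eqP xyi]].
  by rewrite eqxx; split=> //; apply/forallP => j; rewrite eqxx implybT.
apply/ffunP => j; have [->//|ji] := eqVneq j i.
exact/eqP/(implyP (h j)).
Qed.

Lemma inv_sqrtC2_sq : (sqrtC 2)^-1 * (sqrtC 2)^-1 = 2^-1 :> C.
Proof. by rewrite -expr2 exprVn sqrtCK. Qed.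

Lemma hadamard1_conj x y : (((if x && y then -1 else 1) / sqrtC 2 : C))^* =
  (if x && y then -1 else 1) / sqrtC 2.
Proof.
apply/CrealP/realM; first by case: ifP; rewrite ?realN real1.
by rewrite realV ger0_real // sqrtC_ge0 ler0n.
Qed.

Lemma hadamard_maps_paulis i : maps_paulis (hadamard i).
Proof.
rewrite hadamardE; apply: local_op_maps_paulis => b.
(* Hadamard exchanges X and Z, hence swaps the label bits, and sends Y to -Y. *)
exists (b.2, b.1), (b.1 && b.2) => x y.
under eq_bigr => v _.
  under eq_bigr => u _ do rewrite hadamard1_conj mulrAC.
  rewrite -mulr_suml mulrACA inv_sqrtC2_sq; over.
rewrite -mulr_suml !big_bool; apply: (mulIf (x := 2)); first by rewrite pnatr_eq0.
rewrite mulfVK ?pnatr_eq0 //.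
case: b => [[] []]; case: x; case: y;
  rewrite /= ?simpC; ring.
Qed.

Lemma phase_maps_paulis i : maps_paulis (phase i).
Proof.
rewrite phaseE; apply: local_op_maps_paulis => b.
(* Conjugation by the phase gate fixes Z and sends Y to X and X to -Y; only label X gets a sign. *)
exists (b.1 (+) b.2, b.2), (b.2 && ~~ b.1) => x y.
rewrite !big_bool; case: b => [[] []]; case: x; case: y;
  rewrite /= ?simpC //.
Qed.

Definition cnot_fun (c t : 'I_n) (y : qb n) : qb n :=
  [ffun j => if j == t then addb (y t) (y c) else y j].

(** CNOT is a permutation matrix, so conjugation only relabels entries. *)
Lemma cnot_conj c t (X : Op R n) x y :
  ent (dag (cnot c t) *m X *m cnot c t) x y =
  ent X (cnot_fun c t x) (cnot_fun c t y).
Proof.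
rewrite entM; under eq_bigr => v _.
  rewrite entM; under eq_bigr => u _ do rewrite ent_dag ent_mkfmx conjC_nat mulrC.
  rewrite (sum_mul_eq (fun u => ent X u v)) ent_mkfmx; over.
by rewrite (sum_mul_eq (fun v => ent X _ v)).
Qed.

(** True exactly for control (x) target equal to X (x) Z or Y (x) Y, which CNOT exchanges up to a
    minus sign. *)
Definition cnot_sign (a b : bool * bool) : bool :=
  [&& a.2, b.1 & a.1 == b.2].

(** The X bit spreads from control to target and the Z bit from target to control. *)
Lemma cnot_pauli1 a b xc xt yc yt :
  pauli1 a xc yc * pauli1 b (xt (+) xc) (yt (+) yc) =
  (-1) ^+ cnot_sign a b *
    (pauli1 (a.1 (+) b.1, a.2) xc yc * pauli1 (b.1, b.2 (+) a.2) xt yt) :> C.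
Proof.
case: a => [[] []]; case: b => [[] []]; case: xc; case: xt; case: yc; case: yt;
  rewrite /= ?simpC //.
Qed.

Lemma cnot_maps_paulis c t : c != t -> maps_paulis (cnot c t).
Proof.
move=> ct a; have tc : t != c by rewrite eq_sym.
pose b : plab n := [ffun j => if j == c then ((a c).1 (+) (a t).1, (a c).2)
  else if j == t then ((a t).1, (a t).2 (+) (a c).2) else a j].
apply: (@maps_paulis_sign _ _ b (cnot_sign (a c) (a t))) => x y.
rewrite cnot_conj !ent_mkfmx.
rewrite (bigD1 c) //= (bigD1 t) //= !ffunE !eqxx (negPf ct) mulrA cnot_pauli1.
rewrite [in RHS](bigD1 c) //= [in RHS](bigD1 t) //= !ffunE !eqxx (negPf tc).
rewrite -!mulrA; congr (_ * (_ * (_ * _))); apply: eq_bigr => j /andP[jc jt].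
by rewrite !ffunE (negPf jc) (negPf jt).
Qed.

Lemma clifford_maps_paulis (g : Op R n) : clifford g -> maps_paulis g.
Proof.
have mulP (h k : Op R n) : maps_paulis h -> maps_paulis k -> maps_paulis (h *m k).
  move=> hh hk a; have [b hb] := hh a; have [c hc] := hk b; exists c.
  have -> : dag (h *m k) *m pauli a *m (h *m k)
            = dag k *m (dag h *m pauli a *m h) *m k by rewrite dagM !mulmxA.
  by case: hb => ->; case: hc => e; rewrite ?mulmxN ?mulNmx e ?opprK;
    [left|right|right|left].
elim=> [a|i k _ IH|i k _ IH|c t k ct _ IH].
- by exists a; left; rewrite dag1 mul1mx mulmx1.
- exact/mulP/IH/hadamard_maps_paulis.
- exact/mulP/IH/phase_maps_paulis.
- exact/mulP/IH/cnot_maps_paulis.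
Qed.

End Clifford.

(** * Frame operators and the bias *)

Section Frame.
Variables (R : realType) (n : nat).
Local Notation C := R[i].
Local Notation d := ((2 ^ n)%:R : C).
Variables (G : seq (Op R n)) (p : Op R n -> R).
Hypothesis cliffG : forall g, g \in G -> clifford g.

(** For distinct labels the inner product would be both 0 and -d. With [pauli_inj] this makes the
    label in [Xi_is] unique whatever the sign. *)
Lemma pauli_eqN (a b : plab n) : pauli b = - pauli a :> Op R n -> a = b.
Proof.
move=> h; have := pauli_orth R a b.
rewrite h /hs mulmxN raddfN /= -/(hs _ _) pauli_orth eqxx mulr1.
have [//|_] := eqVneq a b; rewrite mulr0 => /eqP.
by rewrite oppr_eq0 (negPf (natr2n_neq0 _ _)).
Qed.

(** The sign of g^dagger Z_z g occurs once in the coefficient and once in the operator, so it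
    cancels. *)
Lemma omegaD_Mso_omega (g X : Op R n) : clifford g ->
  omegaD g (Mso (omega g X)) =
  d^-1 *: \sum_(z : qb n) \sum_(a | Xi_is g z a) hs (pauli a) X *: pauli a.
Proof.
move=> cg; rewrite MsoE /omegaD -scalemxAr -scalemxAl mulmx_sumr mulmx_suml.
congr (_ *: _); apply: eq_bigr => z _.
rewrite -scalemxAr -scalemxAl.
have -> : hs (Zop z) (omega g X) = hs (dag g *m Zop z *m g) X.
  rewrite /hs /omega !dagM dagK !mulmxA -(mulmxA _ X (dag g)) mxtrace_mulC.
  by rewrite mxtrace_mulC mulmxA mxtrace_mulC !mulmxA.
have [b hb] := clifford_maps_paulis cg [ffun i => (z i, false)].
(* For each z exactly one label satisfies [Xi_is g z]. *)
rewrite (big_pred1 b) => [|a]; last first.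
  rewrite /Xi_is /= /Zop; case: hb => ->.
    apply/orP/eqP => [[/eqP/pauli_inj //|/eqP/pauli_eqN //]|->].
    by left; rewrite eqxx.
  apply/orP/eqP => [[/eqP/esym/pauli_eqN //|/eqP/oppr_inj/pauli_inj //]|->].
  by right; rewrite eqxx.
rewrite /Zop; case: hb => ->; first by [].
by rewrite hsNl scaleNr scalerN opprK.
Qed.

(** Stated for an operator [F g] depending on g, so that it covers the ideal frame operator
    (constant [F]) and the noisy one. *)
Lemma frame_sum (F : Op R n -> Op R n) :
  \sum_(g <- G) toC (p g) *: omegaD g (Mso (omega g (F g))) =
  d^-1 *: \sum_(a : plab n)
    hs (pauli a) (\sum_(z : qb n) \sum_(g <- G | Xi_is g z a) toC (p g) *: F g)
      *: pauli a.
Proof.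
pose T g a : Op R n := (toC (p g) * hs (pauli a) (F g)) *: pauli a.
transitivity (d^-1 *: \sum_(g <- G) \sum_(z : qb n) \sum_(a | Xi_is g z a) T g a).
  rewrite scaler_sumr; apply: eq_big_seq => g /cliffG cg.
  rewrite omegaD_Mso_omega // scalerA mulrC -scalerA scaler_sumr; congr (_ *: _).
  apply: eq_bigr => z _; rewrite scaler_sumr.
  by apply: eq_bigr => a _; rewrite scalerA.
congr (_ *: _).
transitivity (\sum_a \sum_(z : qb n) \sum_(g <- G) if Xi_is g z a then T g a else 0).
  rewrite exchange_big [RHS]exchange_big /=; apply: eq_bigr => z _.
  by rewrite [RHS]exchange_big; apply: eq_bigr => g _; rewrite big_mkcond.
apply: eq_bigr => a _; rewrite hs_sumr scaler_suml; apply: eq_bigr => z _.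
rewrite hs_sumr scaler_suml -big_mkcond /=.
by apply: eq_bigr => g _; rewrite hsZr.
Qed.

Lemma frameSE X :
  frameS G p X =
  d^-1 *: \sum_(a : plab n) (toC (s_coef G p a) * hs (pauli a) X) *: pauli a.
Proof.
rewrite /frameS (frame_sum (fun=> X)); congr (_ *: _); apply: eq_bigr => a _.
congr (_ *: _); rewrite -hsZr; congr hs; rewrite /s_coef toC_sum scaler_suml.
by apply: eq_bigr => z _; rewrite toC_sum scaler_suml.
Qed.

Lemma hs_pauli_sum (c : plab n -> C) (b : plab n) :
  hs (pauli b) (d^-1 *: \sum_a c a *: pauli a) = c b.
Proof.
rewrite hsZr hs_sumr; apply: (mulfI (natr2n_neq0 n C)).
rewrite mulVKf ?natr2n_neq0 // -[c b](sum_mul_eq c) mulr_sumr.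
apply: eq_bigr => a _; rewrite hsZr pauli_orth (eq_sym b); ring.
Qed.

Variable Sinv : Op R n -> Op R n.
Hypothesis SinvK : forall X, Sinv (frameS G p X) = X.

(** S is diagonal in the Pauli basis with eigenvalues s_a; if s_a = 0, the nonzero sigma_a and 0
    would have the same image under S. *)
Lemma s_coef_neq0 a : s_coef G p a != 0.
Proof.
apply/eqP => s0; have /eqP := pauli_neq0 R a; apply.
suff e : frameS G p (pauli a) = frameS G p 0 by rewrite -[LHS]SinvK e SinvK.
rewrite !frameSE.
congr (_ *: _).
apply: eq_bigr => b _.
rewrite pauli_orth /hs mulmx0 mxtrace0 mulr0.
have [->|_] := eqVneq b a; last by rewrite !mulr0.
by rewrite s0 toC0 mul0r.
Qed.

Section Noise.
Variable Lam : Op R n -> Op R n -> Op R n.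

Lemma s_Lambar a X :
  \sum_(z : qb n) \sum_(g <- G | Xi_is g z a) toC (p g) *: Lam g X =
  toC (s_coef G p a) *: Lambar G p Lam a X.
Proof.
have s0 := s_coef_neq0 a.
by rewrite /Lambar scalerA -toCM divff // toC1 scale1r.
Qed.

(** S maps the right side to the noisy frame operator at X, because s_a times the coefficient of
    sigma_a is the unnormalised average; applying [Sinv] concludes. *)
Lemma Sinv_frameSt X :
  Sinv (frameSt G p Lam X) =
  d^-1 *: \sum_(a : plab n) hs (pauli a) (Lambar G p Lam a X) *: pauli a.
Proof.
rewrite -[RHS]SinvK frameSE.
congr (Sinv _).
rewrite /frameSt.
rewrite (frame_sum (fun g => Lam g X)).
congr (_ *: _).
apply: eq_bigr => a _.
congr (_ *: _).
rewrite hs_pauli_sum.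
rewrite s_Lambar.
by rewrite hsZr.
Qed.

(** As O is Hermitian, Tr(O rho) = (O|rho); Parseval expands it over the same Pauli labels as the
    estimator, and the two sums are subtracted termwise. *)
Lemma biasE O rho : herm_op O ->
  toC (bias G p Lam Sinv O rho) =
  `|d^-1 * \sum_(a : plab n)
     hs O (pauli a) * hs (pauli a) (id_minus (Lambar G p Lam a) rho)|.
Proof.
move=> hO; rewrite /bias toC_cabs -{1}hO -/(hs O rho); congr (`|_|).
apply: (mulfI (natr2n_neq0 n C)); rewrite mulVKf ?natr2n_neq0 // mulrBr.
rewrite -pauli_parseval Sinv_frameSt hsZr mulVKf ?natr2n_neq0 // hs_sumr -sumrB.
by apply: eq_bigr => a _; rewrite hsZr /id_minus hsBr mulrBr [X in _ - X]mulrC.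
Qed.

Lemma bias_le_stnorm O rho (m : R) : herm_op O ->
  (forall a, `|hs (pauli a) (id_minus (Lambar G p Lam a) rho)| <= toC m) ->
  bias G p Lam Sinv O rho <= stnorm O * m.
Proof.
move=> hO hm; rewrite -toC_le biasE // /stnorm !toCM toCV toC_nat toC_sum.
rewrite normrM normfV normr_nat -mulrA; apply: ler_wpM2l.
  by rewrite invr_ge0 ler0n.
apply: le_trans (ler_norm_sum _ _ _) _; rewrite mulr_suml; apply: ler_sum => a _.
by rewrite normrM toC_cabs -hs_conj norm_conjC; apply: ler_wpM2l.
Qed.

(** The weights p(g)/s_a sum to one, so the identity can be moved inside the average. *)
Lemma id_minus_Lambar a X :
  id_minus (Lambar G p Lam a) X =
  \sum_(z : qb n) \sum_(g <- G | Xi_is g z a)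
    toC ((s_coef G p a)^-1 * p g) *: id_minus (Lam g) X.
Proof.
have s0 := s_coef_neq0 a.
transitivity (toC (s_coef G p a)^-1 *: (toC (s_coef G p a) *: X) -
    Lambar G p Lam a X).
  by rewrite scalerA -toCM mulVf // toC1 scale1r.
rewrite /Lambar -scalerBr {2}/s_coef toC_sum scaler_suml -sumrB scaler_sumr.
apply: eq_bigr => z _; rewrite toC_sum scaler_suml -sumrB scaler_sumr.
by apply: eq_bigr => g _; rewrite /id_minus -scalerBr scalerA -toCM.
Qed.

Lemma sum_weights a :
  \sum_(z : qb n) \sum_(g <- G | Xi_is g z a) (s_coef G p a)^-1 * p g = 1.
Proof.
rewrite -[RHS](mulVf (s_coef_neq0 a)) {3}/s_coef mulr_sumr.
by apply: eq_bigr => z _; rewrite mulr_sumr.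
Qed.

Lemma id_minus_Lambar_linear a :
  (forall g, g \in G -> linear_so (Lam g)) ->
  linear_so (id_minus (Lambar G p Lam a)).
Proof.
move=> linL c X Y; rewrite !id_minus_Lambar scaler_sumr -big_split /=.
apply: eq_bigr => z _; rewrite scaler_sumr -big_split /= big_seq_cond.
rewrite [RHS]big_seq_cond; apply: eq_bigr => g /andP[gG _].
by rewrite (id_minus_linear (linL g gG)) scalerDr !scalerA mulrC.
Qed.

Hypothesis p_ge0 : forall g, g \in G -> 0 <= p g.

Lemma s_coef_ge0 a : 0 <= s_coef G p a.
Proof.
apply: sumr_ge0 => z _; rewrite big_seq_cond.
by apply: sumr_ge0 => g /andP[gG _]; apply: p_ge0.
Qed.

Lemma dnorm_id_minus_Lambar_le a (m : R) :
  (forall g, g \in G -> linear_so (Lam g)) ->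
  (forall g, g \in G -> dnorm (id_minus (Lam g)) <= m) ->
  dnorm (id_minus (Lambar G p Lam a)) <= m.
Proof.
move=> linL hm; apply: dnorm_le => X hX.
have -> : ext_so (id_minus (Lambar G p Lam a)) X =
    \sum_(z : qb n) \sum_(g <- G | Xi_is g z a)
      toC ((s_coef G p a)^-1 * p g) *: ext_so (id_minus (Lam g)) X.
  apply: entP => i j; rewrite ent_ext_so id_minus_Lambar !ent_sum.
  apply: eq_bigr => z _; rewrite !ent_sum; apply: eq_bigr => g _.
  by rewrite !entZ ent_ext_so.
rewrite -[m]mul1r -(sum_weights a) mulr_suml.
apply: le_trans (trnorm_sum _ _ _) _; apply: ler_sum => z _.
apply: le_trans (trnorm_sum _ _ _) _; rewrite mulr_suml.
rewrite big_seq_cond [leRHS]big_seq_cond; apply: ler_sum => g /andP[gG _].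
apply: le_trans (trnormZ _ _) _.
(* Nonnegative weights equal their moduli, which makes the average a convex combination. *)
have w0 : 0 <= (s_coef G p a)^-1 * p g.
  by rewrite mulr_ge0 ?invr_ge0 ?s_coef_ge0 ?p_ge0.
have -> : cabs (toC ((s_coef G p a)^-1 * p g)) = (s_coef G p a)^-1 * p g.
  by apply: toC_inj; rewrite toC_cabs toC_norm.
apply: ler_wpM2l => //; apply: le_trans (hm g gG); apply: le_dnorm => //.
exact: id_minus_linear (linL g gG).
Qed.

End Noise.
End Frame.

(** * Pauli noise and the Hilbert-Schmidt bound *)

Section PauliChannels.
Variables (R : realType) (n : nat).
Local Notation C := R[i].

(** Pauli operators are Hermitian and the q_b real, so a Pauli channel is self-adjoint and its
    eigenvalue on sigma_a can be read off on the left of the pairing. *)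
Lemma pauli_channel_hs (Phi : Op R n -> Op R n) (a : plab n) (l : C) X :
  pauli_channel Phi -> Phi (pauli a) = l *: pauli a ->
  hs (pauli a) (Phi X) = l * hs (pauli a) X.
Proof.
case=> q [_ _ PhiE] ha.
have sym : hs (pauli a) (Phi X) = \tr (Phi (pauli a) *m X).
  rewrite !PhiE hs_sumr mulmx_suml raddf_sum; apply: eq_bigr => b _ /=.
  rewrite hsZr -scalemxAl mxtraceZ; congr (_ * _).
  by rewrite /hs pauli_herm mulmxA mxtrace_mulC !mulmxA.
by rewrite sym ha -scalemxAl mxtraceZ /hs pauli_herm.
Qed.

Lemma pauli_state_le1 (a : plab n) (rho : Op R n) :
  qstate rho -> `|hs (pauli a) rho| <= 1.
Proof.
case=> prho trrho; rewrite -trrho; apply: le_trans (psd_trnorm prho).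
apply: tr_contraction_le; apply: isometry_contraction.
by rewrite dagK pauli_herm pauli_sq.
Qed.

(** Cauchy-Schwarz through Lagrange's identity: twice the difference of the sides is a sum of
    squares. *)
Lemma sum_mul_sq_le (I : finType) (x y : I -> R) :
  (\sum_i x i * y i) ^+ 2 <= (\sum_i x i ^+ 2) * (\sum_i y i ^+ 2).
Proof.
have : 0 <= \sum_i \sum_j (x i * y j - x j * y i) ^+ 2.
  by apply: sumr_ge0 => i _; apply: sumr_ge0 => j _; rewrite sqr_ge0.
have -> : \sum_i \sum_j (x i * y j - x j * y i) ^+ 2 =
    ((\sum_i x i ^+ 2) * (\sum_i y i ^+ 2) - (\sum_i x i * y i) ^+ 2) *+ 2.
  transitivity (\sum_i \sum_j (x i ^+ 2 * y j ^+ 2) +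
      \sum_i \sum_j (x j ^+ 2 * y i ^+ 2) -
      (\sum_i \sum_j (x i * y i) * (x j * y j)) *+ 2).
    rewrite -big_split /= -sumrMnl -sumrB; apply: eq_bigr => i _.
    rewrite -big_split /= -sumrMnl -sumrB; apply: eq_bigr => j _; ring.
  rewrite [X in _ + X - _]exchange_big /= -mulr2n mulrnBl expr2 !mulr_suml.
  by congr (_ *+ 2 - _ *+ 2); apply: eq_bigr => i _; rewrite mulr_sumr.
by rewrite pmulrn_lge0 // subr_ge0.
Qed.

Lemma sum_pauli_cabs_sq (X : Op R n) :
  toC (\sum_(a : plab n) cabs (hs (pauli a) X) ^+ 2) = (2 ^ n)%:R * hs X X.
Proof.
rewrite toC_sum -pauli_parseval; apply: eq_bigr => a _.
by rewrite expr2 toCM !toC_cabs -expr2 normCK hs_conj mulrC.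
Qed.

(** After Cauchy-Schwarz, Parseval contributes a factor d for O and one for rho, cancelling d^-2 in
    the square; the purity of rho is at most one. *)
Lemma sum_pauli_le_hsnorm (O rho : Op R n) : qstate rho ->
  (2 ^ n)%:R^-1 * (\sum_(a : plab n)
     cabs (hs (pauli a) O) * cabs (hs (pauli a) rho)) <= hsnorm O.
Proof.
case=> prho trrho; set t := \sum_a _.
have d0 : 0 < (2 ^ n)%:R :> R by rewrite ltr0n expn_gt0.
have t0 : 0 <= (2 ^ n)%:R^-1 * t.
  rewrite mulr_ge0 ?invr_ge0 ?ler0n //; apply: sumr_ge0 => a _.
  by rewrite mulr_ge0 ?cabs_ge0.
rewrite -[leLHS]ger0_norm // -sqrtr_sqr; apply: ler_wsqrtr.
rewrite -toC_le toC_Re; last exact/ger0_real/hs_ge0.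
have h1 := sum_mul_sq_le (fun a : plab n => cabs (hs (pauli a) O))
  (fun a => cabs (hs (pauli a) rho)).
move: h1; rewrite -/t -toC_le toCM !sum_pauli_cabs_sq => h1.
have rho1 : hs rho rho <= 1 by have := psd_hs prho; rewrite trrho expr1n.
have dC : 0 < (2 ^ n)%:R :> C by rewrite ltr0n expn_gt0.
rewrite exprMn toCM exprVn toCV mulrC.
have -> : toC ((2 ^ n)%:R ^+ 2 : R) = (2 ^ n)%:R ^+ 2 by rewrite -natrX toC_nat natrX.
rewrite ler_pdivrMr ?exprn_gt0 //; apply: le_trans h1 _.
rewrite mulrACA mulrC -expr2; apply: ler_wpM2r; first by rewrite exprn_ge0 // ltW.
by rewrite -[leRHS]mulr1; apply: ler_wpM2l => //; apply: hs_ge0.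
Qed.

End PauliChannels.

Section PauliBias.
Variables (R : realType) (n : nat) (G : seq (Op R n)) (p : Op R n -> R).
Variables (Lam : Op R n -> Op R n -> Op R n) (Sinv : Op R n -> Op R n).
Variables (lam : Op R n -> plab n -> R[i]).
Hypothesis cliffG : forall g, g \in G -> clifford g.
Hypothesis SinvK : forall X, Sinv (frameS G p X) = X.
Hypothesis pauliLam : forall g, g \in G -> pauli_channel (Lam g).
Hypothesis lamE : forall g a, g \in G -> Lam g (pauli a) = lam g a *: pauli a.

Lemma hs_id_minus_Lambar a X :
  hs (pauli a) (id_minus (Lambar G p Lam a) X) =
  (1 - lambar G p lam a) * hs (pauli a) X.
Proof.
rewrite /id_minus hsBr mulrBl mul1r /Lambar hsZr hs_sumr; congr (_ - _).
rewrite /lambar -mulrA; congr (_ * _); rewrite mulr_suml; apply: eq_bigr => z _.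
rewrite hs_sumr mulr_suml big_seq_cond [RHS]big_seq_cond.
apply: eq_bigr => g /andP[gG _]; rewrite hsZr -mulrA; congr (_ * _).
by apply: pauli_channel_hs; [exact: pauliLam | exact: lamE].
Qed.

Lemma pauli_bias_le O rho (m : R) : herm_op O -> qstate rho ->
  (forall a, cabs (1 - lambar G p lam a) <= m) ->
  bias G p Lam Sinv O rho <= Num.min (hsnorm O) (stnorm O) * m.
Proof.
move=> hO hrho hm.
(* The factor |(sigma_a|rho)| is kept: it is bounded by one for the stabilizer norm and summed by
   Cauchy-Schwarz for the 2-norm. *)
have hm' a : `|hs (pauli a) (id_minus (Lambar G p Lam a) rho)| <=
    toC m * `|hs (pauli a) rho|.
  rewrite hs_id_minus_Lambar normrM; apply: ler_wpM2r => //.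
  by rewrite -toC_cabs toC_le.
(* Any label shows that [m] is nonnegative; the one of the identity is taken. *)
have m0 : 0 <= m := le_trans (cabs_ge0 _) (hm [ffun=> (false, false)]).
rewrite minEle; case: ifP => _; last first.
  apply: bias_le_stnorm => // a; apply: le_trans (hm' a) _.
  by rewrite -[leRHS]mulr1; apply: ler_wpM2l; rewrite ?toC_ge0 // pauli_state_le1.
have h := ler_wpM2r m0 (sum_pauli_le_hsnorm O hrho).
apply: le_trans h; rewrite -toC_le biasE // !toCM toCV toC_nat toC_sum.
rewrite normrM normfV normr_nat -mulrA; apply: ler_wpM2l.
  by rewrite invr_ge0 ler0n.
apply: le_trans (ler_norm_sum _ _ _) _; rewrite mulr_suml; apply: ler_sum => a _.
rewrite normrM toCM !toC_cabs -hs_conj norm_conjC -mulrA; apply: ler_wpM2l => //.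
by rewrite mulrC hm'.
Qed.

End PauliBias.

Theorem theorem1 (R : realType) (n : nat) (G : seq (Op R n)) (p : Op R n -> R)
  (Lam : Op R n -> Op R n -> Op R n) (Sinv : Op R n -> Op R n) (O rho : Op R n) :
  (0 < n)%N ->
  uniq G -> (forall g, g \in G -> clifford g) ->
  (forall g, g \in G -> 0 <= p g) -> \sum_(g <- G) p g = 1 ->
  (* S is invertible, with inverse Sinv *)
  (forall X, Sinv (frameS G p X) = X) -> (forall X, frameS G p (Sinv X) = X) ->
  (forall g, clifford g -> channel (Lam g)) ->
  herm_op O -> qstate rho ->
  (bias G p Lam Sinv O rho
     <= stnorm O * \big[Num.max/0]_(a : plab n) dnorm (id_minus (Lambar G p Lam a))
   /\ stnorm O * \big[Num.max/0]_(a : plab n) dnorm (id_minus (Lambar G p Lam a))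
     <= stnorm O * sup [set r : R | exists g, clifford g /\ r = dnorm (id_minus (Lam g))])
  /\
  ((forall g, clifford g -> pauli_channel (Lam g)) ->
   forall lam : Op R n -> plab n -> R[i],
     (forall g a, clifford g -> Lam g (pauli a) = lam g a *: pauli a) ->
     bias G p Lam Sinv O rho
       <= Num.min (hsnorm O) (stnorm O)
          * \big[Num.max/0]_(a : plab n) cabs (1 - lambar G p lam a)).
Proof.
move=> _ _ cliffG p_ge0 _ SinvK _ chanLam hO hrho.
have linG g : g \in G -> linear_so (Lam g).
  by move=> /cliffG/chanLam[].
split; last first.
  move=> pauliLam lam lamE; apply: pauli_bias_le => //.
  - by move=> g /cliffG; apply: pauliLam.
  - by move=> g a /cliffG; apply: lamE.
  - by move=> a; apply: le_bigmax.
split.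
  apply: bias_le_stnorm => // a.
  (* The all-zero bit string is the ancilla basis state; the unitary will be sigma_a^dagger. *)
  have h := tr_unitary_le_dnorm [ffun=> false]
    (id_minus_Lambar_linear cliffG SinvK a linG) _ hrho.
  apply: le_trans (h (dag (pauli a)) _) _.
    by rewrite dagK pauli_herm pauli_sq.
  by rewrite toC_le; apply: (le_bigmax _ (fun a => dnorm (id_minus (Lambar G p Lam a)))).
have st0 : 0 <= stnorm O.
  rewrite mulr_ge0 ?invr_ge0 ?ler0n //.
  by apply: sumr_ge0 => a _; apply: cabs_ge0.
apply: ler_wpM2l => //.
have [M hM] := channel_dnorm_bounded R (qb n).
have le_sup g : clifford g -> dnorm (id_minus (Lam g)) <=
    sup [set r : R | exists g, clifford g /\ r = dnorm (id_minus (Lam g))].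
  move=> cg; apply: ub_le_sup; last by exists g.
  by exists M => _ [h [ch ->]]; apply/hM/chanLam.
(* The default 0 of the maximum must also lie below the supremum; the identity, a Clifford element,
   witnesses this. *)
apply: bigmax_le => [|a _].
  apply: (le_trans _ (le_sup _ cl_one)); apply: dnorm_ge0.
  by apply: id_minus_linear; case: (chanLam _ cl_one).
by apply: (dnorm_id_minus_Lambar_le cliffG SinvK) => // g /cliffG; apply: le_sup.
Qed.
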